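(* Let $G$ be a finite group. Then the following are equivalent. (a) $\mathcal{E}(G)$ is diamond-free; (b) every nontrivial cyclic subgroup of $G$ is contained in a unique maximal cyclic subgroup; (c) $\mathrm{sl}(\mathcal{E}(G))\supseteq G\setminus\{1\}$; (d) $G$ is cyclic or $G$ admits a nontrivial partition consisting of cyclic subgroups; (e) $\mathcal{E}(G)$ is a block graph and a cograph in which any two distinct maximal cliques meet in the identity element of $G$; (f) $\mathcal{E}(G)$ is a block graph; (g) $G$ is cyclic or $G$ is a C-tidy group with $\mathrm{Cyc}(G)=1$; (h) $G$ is cyclic-transitive.
   Context: All graphs are finite, undirected and simple. The enhanced power graph $\mathcal{E}(G)$ of a group $G$ is the graph with vertex set $G$ in which $\{x,y\}$ is an edge if and only if $x\neq y$ and $\langle x,y\rangle$ is cyclic. A diamond is the graph obtained from the complete graph $K_4$ by deleting one edge. For a graph $\Delta$, a graph is $\Delta$-free if it has no induced subgraph isomorphic to $\Delta$; a cograph is a $P_4$-free graph, where $P_4$ is the path with four vertices. A clique of a graph is a set of pairwise adjacent vertices; maximal cliques are maximal with respect to inclusion. A vertex $x$ of a graph $\Gamma$ is simplicial if the closed neighbourhood of $x$ (that is, $x$ together with its neighbours) induces a complete graph; $\mathrm{sl}(\Gamma)$ is the set of simplicial vertices of $\Gamma$. A graph $\Gamma=(V,E)$ is $2$-connected if $|V|\geq 2$, $\Gamma$ is connected, and $\Gamma-x$ is connected for each $x\in V$. A block of a connected graph with at least two vertices is a subgraph that is maximal (under the subgraph relation) among its $2$-connected subgraphs; the blocks of an arbitrary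 graph are the blocks of its connected components with at least two vertices. A graph is a block graph if each of its blocks is a complete graph. A maximal cyclic subgroup of $G$ is a cyclic subgroup not properly contained in another cyclic subgroup of $G$. A nontrivial partition of a non-identity group $G$ is a set $\{H_1,\dots,H_n\}$ of $n\geq 2$ proper nontrivial subgroups of $G$ such that $G=\bigcup_{i=1}^n H_i$ and $H_i\cap H_j=1$ for distinct $i,j$. For $x\in G$ let $\mathrm{Cyc}(x)=\{y\in G:\langle y,x\rangle\text{ is cyclic}\}$, and let $\mathrm{Cyc}(G)=\bigcap_{x\in G}\mathrm{Cyc}(x)$. A group $G$ is C-tidy if for every $x\in G\setminus\mathrm{Cyc}(G)$ the set $\mathrm{Cyc}(x)$ is a cyclic subgroup of $G$. A group $G$ is cyclic-transitive if for all $x,y,z\in G\setminus\{1\}$, $\langle x,y\rangle$ and $\langle y,z\rangle$ cyclic implies $\langle x,z\rangle$ cyclic. *)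

(* Defs.v *)
From mathcomp Require Import all_boot all_fingroup all_solvable.

Set Implicit Arguments.
Unset Strict Implicit.
Unset Printing Implicit Defensive.

Local Open Scope group_scope.

Section Graphs.

Implicit Types T U : finType.

Definition graph_axiom T (V : {set T}) (E : {set {set T}}) : bool :=
  [forall e in E, (e \subset V) && (#|e| == 2)].

(* The vertex set is a subset of an ambient finite type, so that a graph and
   its subgraphs inhabit the same type. *)
Record graph T := Graph {
  vertices : {set T};
  edges : {set {set T}};
  _ : graph_axiom vertices edges }.

Definition adj T (g : graph T) : rel T := [rel x y | [set x; y] \in edges g].

Fact graph_on_subproof T (V : {set T}) (r : rel T) :
  graph_axiom V [set [set x; y] | x in V, y in V & (x != y) && r x y].
Proof.
apply/forall_inP => e /imset2P[x y Vx]; rewrite inE => /and3P[Vy nxy _] ->.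
by rewrite subUset !sub1set Vx Vy cards2 nxy.
Qed.

(* r need not be symmetric: {x, y} is an edge when r x y or r y x holds. *)
Definition graph_on T (V : {set T}) (r : rel T) : graph T :=
  Graph (graph_on_subproof V r).

Fact induced_subproof T (g : graph T) (A : {set T}) :
  graph_axiom (vertices g :&: A) [set e in edges g | e \subset A].
Proof.
apply/forall_inP => e; rewrite inE => /andP[ge sAe].
case: g ge => V E /= /forall_inP gP /gP /andP[sVe ->].
by rewrite subsetI sVe sAe.
Qed.

Definition induced T (g : graph T) (A : {set T}) : graph T :=
  Graph (induced_subproof g A).

Fact delete_edge_subproof T (g : graph T) (e : {set T}) :
  graph_axiom (vertices g) (edges g :\ e).
Proof.
apply/forall_inP => f; rewrite inE => /andP[_].
by case: g => V E /= /forall_inP gP /gP.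
Qed.

Definition delete_edge T (g : graph T) (e : {set T}) : graph T :=
  Graph (delete_edge_subproof g e).

Definition delete_vertex T (g : graph T) (x : T) : graph T :=
  induced g (~: [set x]).

Definition subgraph T (h g : graph T) : bool :=
  (vertices h \subset vertices g) && (edges h \subset edges g).

Definition complete T (g : graph T) : bool :=
  [forall x in vertices g, forall y in vertices g, (x != y) ==> adj g x y].

Definition isomorphic T U (g : graph T) (h : graph U) : Prop :=
  exists f : T -> U,
    [/\ {in vertices g &, injective f},
        f @: vertices g = vertices h &
        {in vertices g &, forall x y, adj h (f x) (f y) = adj g x y}].

Definition free_of U (d : graph U) T (g : graph T) : Prop :=
  forall A : {set T}, A \subset vertices g -> ~ isomorphic d (induced g A).

Definition complete_graph n : graph 'I_n := graph_on [set: 'I_n] [rel i j | true].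

Definition path_graph n : graph 'I_n :=
  graph_on [set: 'I_n] [rel i j : 'I_n | j == i.+1 :> nat].

Definition diamond : graph 'I_4 :=
  delete_edge (complete_graph 4) [set ord0; ord_max].

Definition diamond_free T (g : graph T) : Prop := free_of diamond g.

Definition cograph T (g : graph T) : Prop := free_of (path_graph 4) g.

Definition clique T (g : graph T) (A : {set T}) : bool :=
  (A \subset vertices g) && [forall x in A, forall y in A, (x != y) ==> adj g x y].

Definition maximal_clique T (g : graph T) (A : {set T}) : bool :=
  maxset (clique g) A.

Definition closed_nbhd T (g : graph T) (x : T) : {set T} :=
  x |: [set y | adj g x y].

Definition simplicial T (g : graph T) (x : T) : bool :=
  (x \in vertices g) && complete (induced g (closed_nbhd g x)).

Definition sl T (g : graph T) : {set T} := [set x | simplicial g x].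

Definition connected T (g : graph T) : Prop :=
  {in vertices g &, forall x y, connect (adj g) x y}.

Definition two_connected T (g : graph T) : Prop :=
  [/\ 2 <= #|vertices g|, connected g &
      forall x, x \in vertices g -> connected (delete_vertex g x)].

Definition component T (g : graph T) (x : T) : graph T :=
  induced g [set y | connect (adj g) x y].

Definition block_of_connected T (g b : graph T) : Prop :=
  [/\ subgraph b g, two_connected b &
      forall h : graph T,
        subgraph h g -> two_connected h -> subgraph b h -> subgraph h b].

Definition block T (g b : graph T) : Prop :=
  exists x, [/\ x \in vertices g, 2 <= #|vertices (component g x)| &
                block_of_connected (component g x) b].

Definition block_graph T (g : graph T) : Prop :=
  forall b : graph T, block g b -> complete b.

End Graphs.

Section Groups.

Variable gT : finGroupType.
Implicit Types G H M : {group gT}.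

Definition enhanced_power_graph G : graph gT :=
  graph_on G [rel x y | cyclic <<[set x; y]>>].

Definition maximal_cyclic G M : bool := [max M | (M \subset G) && cyclic M].

Definition nontrivial_partition G (P : {set {group gT}}) : Prop :=
  [/\ G :!=: 1, 2 <= #|P|,
      forall H, H \in P -> H \proper G /\ H :!=: 1,
      G :=: \bigcup_(H in P) H &
      {in P &, forall H K : {group gT}, H != K -> H :&: K = 1}].

Definition Cyc G (x : gT) : {set gT} := [set y in G | cyclic <<[set y; x]>>].

Definition Cyc_group G : {set gT} := \bigcap_(x in G) Cyc G x.

Definition C_tidy G : Prop :=
  forall x, x \in G :\: Cyc_group G ->
    exists H : {group gT}, Cyc G x = H /\ cyclic H.

Definition cyclic_transitive G : Prop :=
  {in G^# & &, forall x y z,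
    cyclic <<[set x; y]>> -> cyclic <<[set y; z]>> -> cyclic <<[set x; z]>>}.

End Groups.

(* Main.v *)
Require Import Defs.
From mathcomp Require Import all_boot all_fingroup all_solvable.

Set Implicit Arguments.
Unset Strict Implicit.
Unset Printing Implicit Defensive.

Local Open Scope group_scope.

(** The key notion is the relation [cocyclic x y], meaning that x and y lie in
    a common cyclic subgroup.  It is reflexive and symmetric, and the identity
    is related to everything, so a chain x, 1, z carries no information about
    x and z.  Cyclic-transitivity says that the relation is transitive along
    all other chains x, y, z, i.e. that removing the identity from the enhanced power graph
    leaves a disjoint union of complete graphs; the remaining conditions say
    the same in different languages.

    Group-theoretic conditions: a generator of a maximal cyclic subgroup M is
    cocyclic only with the elements of M ([mem_maximal_cyclic]).  Hence two
    distinct maximal cyclic subgroups M = <[m]> and N = <[n]> have non-cocyclic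
    generators, and any nontrivial h in both gives a failure m, h, n of
    transitivity, a non-simplicial vertex h, and an induced diamond on
    m, 1, h, n.  When no such failure exists the maximal cyclic subgroups
    either are G alone or partition G, and the one containing x != 1 is Cyc(x).

    Graph-theoretic conditions: 1 and y both dominate {1, x, y, z} when x and z
    are cocyclic with y, so these vertices induce a 2-connected graph, which a
    block graph must complete to a clique ([block_graph_clique]).  Conversely,
    if G is cyclic-transitive, a block stays connected without the identity, so
    its vertices are pairwise cocyclic and it is complete ([block_complete]). *)

(** * Adjacency *)

Lemma eq_set2 (T : finType) (x y u v : T) :
  ([set x; y] == [set u; v]) =
  (x == u) && (y == v) || (x == v) && (y == u).
Proof.
apply/eqP/idP => [/setP eqs | ].
  move: (eqs x) (eqs y) (eqs u) (eqs v); rewrite !inE !eqxx ?orbT /=.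
  rewrite (eq_sym u x) (eq_sym v x) (eq_sym u y) (eq_sym v y).
  by case: (x == u); case: (x == v); case: (y == u); case: (y == v).
by case/orP=> /andP[/eqP-> /eqP->] //; rewrite setUC.
Qed.

Lemma adj_graph_on (T : finType) (V : {set T}) (r : rel T) (x y : T) :
  adj (graph_on V r) x y =
  [&& x \in V, y \in V, x != y & r x y || r y x].
Proof.
apply/imset2P/and4P => [[u v Vu]|[Vx Vy nxy]].
  rewrite inE => /and3P[Vv nuv ruv] /eqP.
  rewrite eq_set2 => /orP[] /andP[/eqP-> /eqP->]; rewrite ?ruv ?orbT //.
  by rewrite eq_sym.
case/orP=> rxy; first by exists x y; rewrite // inE Vy nxy.
by exists y x; rewrite ?inE ?Vx 1?eq_sym ?nxy // setUC.
Qed.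

Section GraphTheory.

Variable T : finType.
Implicit Types (g h : graph T) (A : {set T}) (x y : T).

Lemma adjC g x y : adj g x y = adj g y x.
Proof. by rewrite /adj /= setUC. Qed.

Lemma adj_vertices g x y :
  adj g x y -> [/\ x \in vertices g, y \in vertices g & x != y].
Proof.
case: g => V E gVE; rewrite /adj /= => Exy.
move/forall_inP: gVE => /(_ _ Exy) /andP[].
rewrite subUset !sub1set => /andP[-> ->]; rewrite cards2.
by case: (x != y).
Qed.

Lemma adj_induced g A x y :
  adj (induced g A) x y = [&& adj g x y, x \in A & y \in A].
Proof. by rewrite /adj /= inE subUset !sub1set. Qed.

Lemma sub_adj h g x y : subgraph h g -> adj h x y -> adj g x y.
Proof. by case/andP=> _ /subsetP; apply. Qed.

Lemma subgraph_induced h g A :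
  subgraph h g -> vertices h \subset A -> subgraph h (induced g A).
Proof.
case/andP=> sVg sEg sVA; rewrite /subgraph /= subsetI sVg sVA /=.
apply/subsetP=> e he; rewrite inE (subsetP sEg) //=.
case: h he sVA {sVg sEg} => V E /= /forall_inP hP /hP /andP[sVe _] sVA.
exact: subset_trans sVA.
Qed.

Lemma induced_subgraph g A : subgraph (induced g A) g.
Proof.
by rewrite /subgraph subsetIl; apply/subsetP=> e; rewrite inE => /andP[].
Qed.

Lemma subgraph_trans g h k : subgraph k h -> subgraph h g -> subgraph k g.
Proof.
case/andP=> sV sE /andP[sV' sE'].
by rewrite /subgraph (subset_trans sV) ?(subset_trans sE).
Qed.

(** * Two-connected subgraphs and blocks *)

Definition dominating g x :=
  (x \in vertices g) && [forall y in vertices g, (x != y) ==> adj g x y].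

Lemma dominatingP g x :
  reflect (x \in vertices g /\ {in vertices g, forall y, x != y -> adj g x y})
          (dominating g x).
Proof.
apply: (iffP andP) => -[gx].
  by move/forall_inP=> gP; split=> // y /gP /implyP.
by move=> gP; split=> //; apply/forall_inP=> y /gP /implyP.
Qed.

Lemma dominating_induced g A x :
  x \in A -> dominating g x -> dominating (induced g A) x.
Proof.
move=> Ax /dominatingP[gx gP]; apply/dominatingP; split=> [|y].
  by rewrite inE gx.
by rewrite inE adj_induced Ax => /andP[gy ->] /gP->.
Qed.

Lemma dominating_connected g x : dominating g x -> connected g.
Proof.
case/dominatingP=> gx gP y z gy gz.
have cx u : u \in vertices g -> connect (adj g) x u.
  by move=> gu; case: (eqVneq x u) => [-> // | nxu]; apply/connect1/gP.
apply: (connect_trans _ (cx z gz)).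
by rewrite (sym_connect_sym (adjC g)) cx.
Qed.

(** Deleting any vertex leaves at least one of the two dominating vertices. *)
Lemma dominating_two_connected g x y :
  x != y -> dominating g x -> dominating g y -> two_connected g.
Proof.
move=> nxy dx dy; split; last 1 first.
- move=> u gu; case: (eqVneq x u) => [<- | nxu].
    by apply/(@dominating_connected _ y)/dominating_induced; rewrite // !inE eq_sym.
  by apply/(@dominating_connected _ x)/dominating_induced; rewrite // !inE.
- have [[gx _] [gy _]] := (dominatingP _ _ dx, dominatingP _ _ dy).
  rewrite (cardD1 x) gx (cardD1 y) inE /= gy eq_sym nxy //.
exact: dominating_connected dx.
Qed.

Lemma complete_dominating g x :
  complete g -> x \in vertices g -> dominating g x.
Proof. by move=> /forall_inP gP gx; rewrite /dominating gx gP. Qed.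

Lemma complete_two_connected g :
  2 <= #|vertices g| -> complete g -> two_connected g.
Proof.
case/card_gt1P=> x [y [gx gy nxy]] gC.
by apply: (dominating_two_connected nxy); apply: complete_dominating.
Qed.

Lemma two_connected_sub_component h g x :
  subgraph h g -> two_connected h -> x \in vertices h ->
  subgraph h (component g x).
Proof.
move=> shg [_ hC _] hx; apply: subgraph_induced => //.
apply/subsetP=> y hy; rewrite inE.
by apply: (connect_sub _ (hC x y hx hy)) => u v huv; apply/connect1/(sub_adj shg).
Qed.

(** The complete graph on the vertices of b is 2-connected, so by maximality
    it cannot properly extend the block b. *)
Lemma block_complete g (b : graph T) : block g b -> clique g (vertices b) -> complete b.
Proof.
case=> x [_ _ [sbc b2 bmax]] /andP[_ /forall_inP bC].
have [gb _ _] := b2.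
have sVc : vertices b \subset vertices (component g x) by case/andP: sbc.
pose k := induced (component g x) (vertices b).
have kV : vertices k = vertices b by apply/setIidPr.
have kC : complete k.
  rewrite /complete kV; apply/forall_inP=> u bu; apply/forall_inP=> v bv.
  apply/implyP=> nuv; rewrite !adj_induced bu bv !andbT.
  have /forall_inP/(_ v bv)/implyP/(_ nuv)-> := bC u bu.
  have := subsetP sVc _ bu; have := subsetP sVc _ bv.
  by rewrite !inE => /andP[_ ->] /andP[_ ->].
have /andP[_ skb] : subgraph k b.
  apply: bmax; first exact: induced_subgraph.
    by apply: complete_two_connected; rewrite ?kV.
  exact: subgraph_induced.
move/forall_inP: kC; rewrite kV => kC.
apply/forall_inP=> u /kC /forall_inP ku; apply/forall_inP=> v /ku /implyP kuv.
by apply/implyP=> /kuv; apply: (subsetP skb).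
Qed.

(** A 2-connected subgraph extends to a block; the induction runs down on the
    number of vertices and edges still outside h, and reaches a block when no
    extension is proper. *)
Lemma block_graph_clique g h :
  block_graph g -> subgraph h g -> two_connected h -> clique g (vertices h).
Proof.
move=> gB.
have [n] := ubnP (#|~: vertices h| + #|~: edges h|).
elim: n h => // n IHn h; rewrite ltnS => le_n shg h2.
have [/andP[sVg _] [/ltnW/card_gt0P[x hx] _ _]] := (shg, h2).
apply/idPn=> nC; case/negP: (nC); rewrite /clique sVg /=.
have shc := two_connected_sub_component shg h2 hx.
have /gB/forall_inP hC : block g h.
  exists x; split; first exact: (subsetP sVg).
    have [h_gt1 _ _] := h2; have /andP[sVc _] := shc.
    exact: leq_trans h_gt1 (subset_leq_card sVc).
  split=> // k skc k2 shk; apply/idPn=> nskh; case/negP: nC.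
  have skg := subgraph_trans skc (induced_subgraph _ _).
  have /andP[sVk sEk] := shk.
  have /andP[skV kC] : clique g (vertices k).
    apply: IHn => //; apply: leq_trans le_n.
    have leV : #|~: vertices k| <= #|~: vertices h|.
      by rewrite subset_leq_card // setCS.
    have leE : #|~: edges k| <= #|~: edges h|.
      by rewrite subset_leq_card // setCS.
    move: nskh; rewrite /subgraph negb_and -!(setCS (_ k)) => /orP[] ns.
      rewrite -addSn leq_add // proper_card // properE setCS sVk //.
    rewrite -addnS leq_add // proper_card // properE setCS sEk //.
  rewrite /clique sVg; apply/forall_inP=> u /(subsetP sVk) ku.
  apply/forall_inP=> v /(subsetP sVk) kv.
  by have /forall_inP/(_ u ku)/forall_inP/(_ v kv) := kC.
apply/forall_inP=> u /hC/forall_inP hu; apply/forall_inP=> v /hu/implyP huv.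
by apply/implyP=> /huv; apply: sub_adj.
Qed.

(** * Forbidden induced subgraphs *)

Lemma adj_diamond (i j : 'I_4) :
  adj diamond i j =
  (i != j :> nat) && ~~ ((i == 0 :> nat) && (j == 3 :> nat) ||
                         (i == 3 :> nat) && (j == 0 :> nat)).
Proof.
rewrite /diamond /adj /= in_setD1 eq_set2 andbC; congr (_ && _).
by have := adj_graph_on [set: 'I_4] [rel i j | true] i j; rewrite !inE andbT.
Qed.

Lemma adj_path_graph n (i j : 'I_n) :
  adj (path_graph n) i j = (j == i.+1 :> nat) || (i == j.+1 :> nat).
Proof.
rewrite adj_graph_on !inE /= -val_eqE /= andb_idl //.
by case/orP=> /eqP->; rewrite ?(gtn_eqF (ltnSn _)) ?(ltn_eqF (ltnSn _)).
Qed.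

(** In the forward direction a and d are the two vertices that would be
    nonadjacent in the diamond. *)
Lemma diamond_freeP g :
  diamond_free g <->
  forall a b c d, adj g a b -> adj g a c -> adj g b c -> adj g b d ->
    adj g c d -> a != d -> adj g a d.
Proof.
split=> [gF a b c d ab ac bc bd cd nad | gP A sAg [f [f_inj fV fE]]].
  apply/idPn=> nadj; pose s := [:: a; b; c; d].
  have [[ga gb nab] [_ gc nac]] := (adj_vertices ab, adj_vertices ac).
  have [[_ gd nbd] [_ _ ncd]] := (adj_vertices bd, adj_vertices cd).
  have [_ _ nbc] := adj_vertices bc.
  have sU : uniq s by rewrite /= !inE !negb_or nab nac nad nbc nbd ncd.
  have sg : [set x in s] \subset vertices g.
    by apply/subsetP=> x; rewrite !inE => /or4P[] /eqP->.
  apply: (gF _ sg); exists (fun i : 'I_4 => nth a s i); split.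
  - move=> i j _ _ /eqP; rewrite nth_uniq //= => /eqP eij; exact: val_inj.
  - rewrite /= (setIidPr sg); apply/setP=> x; rewrite inE.
    apply/imsetP/(nthP a) => [[i _ ->] | [i lti <-]]; first by exists i.
    by exists (Ordinal (lti : i < 4)); rewrite ?inE.
  - move=> i j _ _; have ns (k : 'I_4) : nth a s k \in [set x in s] by rewrite in_set mem_nth.
    rewrite adj_induced !ns !andbT adj_diamond.
    have irr x : adj g x x = false.
      by apply/negP=> /adj_vertices[_ _]; rewrite eqxx.
    have nda : adj g d a = false by rewrite adjC (negPf nadj).
    case: i j => [[|[|[|[|i]]]] lti] [[|[|[|[|j]]]] ltj] //; rewrite /s /=;
      by rewrite ?irr ?nda ?(negPf nadj) // adjC.
have fadj i j : adj diamond i j -> adj g (f i) (f j).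
  by rewrite -fE ?inE // adj_induced => /and3P[].
have fA i : f i \in A.
  have : f i \in f @: vertices diamond by rewrite imset_f ?inE.
  by rewrite fV in_setI => /andP[].
pose o k (lt_k : k < 4) := Ordinal lt_k.
have := fE (@o 0 isT) (@o 3 isT); rewrite !inE adj_induced !fA adj_diamond /=.
move=> /(_ isT isT) /negbT /negP; case; rewrite !andbT.
have := gP (f (@o 0 isT)) (f (@o 1%N isT)) (f (@o 2 isT)) (f (@o 3 isT)).
apply; rewrite ?fadj ?adj_diamond //.
by apply/eqP=> /f_inj; rewrite !inE => /(_ isT isT) /(congr1 val).
Qed.

(** The three admissible edges are the chords of the path a, b, c, d. *)
Lemma cograph_chordal g :
  (forall a b c d, adj g a b -> adj g b c -> adj g c d -> a != c -> a != d ->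
     b != d -> [|| adj g a c, adj g a d | adj g b d]) ->
  cograph g.
Proof.
move=> gP A sAg [f [f_inj fV fE]].
have fA i : f i \in A.
  have : f i \in f @: vertices (path_graph 4) by rewrite imset_f ?inE.
  by rewrite fV in_setI => /andP[].
have fadj i j : adj g (f i) (f j) = adj (path_graph 4) i j.
  by rewrite -fE ?inE // adj_induced !fA !andbT.
have f_neq i j : i != j -> f i != f j.
  by apply: contraNneq => /f_inj; rewrite !inE => ->.
pose o k (lt_k : k < 4) := Ordinal lt_k.
have := gP (f (@o 0 isT)) (f (@o 1%N isT)) (f (@o 2 isT)) (f (@o 3 isT)).
by rewrite !fadj !adj_path_graph /= !f_neq //; move/(_ isT isT isT isT isT isT).
Qed.

End GraphTheory.

(** * Cocyclic elements and maximal cyclic subgroups *)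

Section EnhancedPowerGraph.

Variable gT : finGroupType.
Implicit Types (G H M N : {group gT}) (A B : {set gT}) (x y z m n : gT).

Definition cocyclic x y := cyclic <<[set x; y]>>.

Lemma cocyclicC x y : cocyclic x y = cocyclic y x.
Proof. by rewrite /cocyclic setUC. Qed.

Lemma cyclic_cocyclic H x y : cyclic H -> x \in H -> y \in H -> cocyclic x y.
Proof.
by move=> cycH Hx Hy; apply: cyclicS cycH; rewrite gen_subG subUset !sub1set Hx.
Qed.

Lemma cocyclic_refl x : cocyclic x x.
Proof. by apply: (cyclic_cocyclic (cycle_cyclic x)); apply: cycle_id. Qed.

Lemma cocyclic1 x : cocyclic 1 x.
Proof. by apply: (cyclic_cocyclic (cycle_cyclic x)); rewrite ?cycle_id. Qed.

Lemma maximal_cyclic_exists G H :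
  H \subset G -> cyclic H -> exists2 M, maximal_cyclic G M & H \subset M.
Proof.
move=> sHG cycH.
have [|M maxM sHM] := @maxgroup_exists _ (fun M => (M \subset G) && cyclic M) H.
  by rewrite sHG.
by exists M.
Qed.

Lemma maximal_cyclic_sub G M : maximal_cyclic G M -> M \subset G.
Proof. by case/maxgroupP=> /andP[]. Qed.

Lemma maximal_cyclic_cyclic G M : maximal_cyclic G M -> cyclic M.
Proof. by case/maxgroupP=> /andP[]. Qed.

(** The subgroup generated by m and y is cyclic and contains M, so it is M. *)
Lemma mem_maximal_cyclic G M m y :
  maximal_cyclic G M -> M :=: <[m]> -> y \in G -> cocyclic m y -> y \in M.
Proof.
case/maxgroupP=> /andP[sMG _] Mmax defM Gy cmy.
have Gm : m \in G by rewrite (subsetP sMG) // defM cycle_id.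
rewrite -[M : {set gT}](Mmax <<[set m; y]>>%G) /=.
- by rewrite mem_gen // !inE eqxx orbT.
- by rewrite gen_subG subUset !sub1set Gm Gy.
by rewrite defM cycle_subG mem_gen // !inE eqxx.
Qed.

Lemma maximal_cyclic_eq G M N m n :
    maximal_cyclic G M -> maximal_cyclic G N ->
    M :=: <[m]> -> N :=: <[n]> -> cocyclic m n ->
  M = N.
Proof.
move=> maxM maxN defM defN cmn.
have Gm : m \in G by rewrite (subsetP (maximal_cyclic_sub maxM)) // defM cycle_id.
have Gn : n \in G by rewrite (subsetP (maximal_cyclic_sub maxN)) // defN cycle_id.
apply/val_inj/eqP; rewrite /= eqEsubset {1}defM {2}defN !cycle_subG.
rewrite (mem_maximal_cyclic maxM defM Gn cmn).
by rewrite (mem_maximal_cyclic maxN defN Gm) // cocyclicC.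
Qed.

Lemma cocyclic_maximal_cyclic G x y :
    x \in G -> y \in G -> cocyclic x y ->
  exists M, [/\ maximal_cyclic G M, x \in M & y \in M].
Proof.
move=> Gx Gy cxy.
have [|M maxM] := @maximal_cyclic_exists G <<[set x; y]>> _ cxy.
  by rewrite gen_subG subUset !sub1set Gx.
by rewrite gen_subG subUset !sub1set => /andP[Mx My]; exists M.
Qed.

Lemma cocyclic_trans G x y z :
    cyclic_transitive G -> x \in G -> y \in G^# -> z \in G ->
  cocyclic x y -> cocyclic y z -> cocyclic x z.
Proof.
move=> trG Gx Gy Gz cxy cyz.
have [-> | ntx] := eqVneq x 1; first exact: cocyclic1.
have [-> | ntz] := eqVneq z 1; first by rewrite cocyclicC cocyclic1.
by apply: (trG x y z); rewrite // !inE ?ntx ?ntz.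
Qed.

(** * The enhanced power graph *)

Lemma adj_epg G x y :
  adj (enhanced_power_graph G) x y =
  [&& x \in G, y \in G, x != y & cocyclic x y].
Proof. by rewrite adj_graph_on /= -!/(cocyclic _ _) (cocyclicC y) orbb. Qed.

Lemma dominating_epg1 G : dominating (enhanced_power_graph G) 1.
Proof.
apply/dominatingP; split=> //= y Gy nt_y.
by rewrite adj_epg group1 Gy nt_y cocyclic1.
Qed.

Lemma clique_epgP G A :
  reflect (A \subset G /\ {in A &, forall x y, cocyclic x y})
          (clique (enhanced_power_graph G) A).
Proof.
apply: (iffP andP) => -[/= sAG AC]; split=> //.
  move=> x y Ax Ay; have [-> | nxy] := eqVneq x y; first exact: cocyclic_refl.
  move/forall_inP/(_ x Ax)/forall_inP/(_ y Ay)/implyP/(_ nxy): AC.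
  by rewrite adj_epg => /and4P[].
apply/forall_inP=> x Ax; apply/forall_inP=> y Ay; apply/implyP=> nxy.
by rewrite adj_epg nxy !(subsetP sAG) // AC.
Qed.

Lemma sl_epgP G x :
  reflect (x \in G /\ {in G &, forall y z,
             cocyclic x y -> cocyclic x z -> cocyclic y z})
          (x \in sl (enhanced_power_graph G)).
Proof.
set g := enhanced_power_graph G.
have nbhdE y : x \in G -> (y \in closed_nbhd g x) = (y \in G) && cocyclic x y.
  move=> Gx; rewrite in_setU1 in_set adj_epg Gx /=.
  by rewrite (eq_sym y); case: eqVneq => //= <-; rewrite Gx cocyclic_refl.
have indE y : x \in G ->
    (y \in vertices (induced g (closed_nbhd g x))) = (y \in G) && cocyclic x y.
  by move=> Gx; rewrite in_setI nbhdE // andbA andbb.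
have adjE y z : x \in G -> y \in G -> z \in G -> cocyclic x y -> cocyclic x z ->
    adj (induced g (closed_nbhd g x)) y z = (y != z) && cocyclic y z.
  move=> Gx Gy Gz cxy cxz.
  by rewrite adj_induced !nbhdE // adj_epg Gy Gz cxy cxz !andbT.
rewrite inE; apply: (iffP andP) => -[/= Gx].
  move/forall_inP=> gC; split=> // y z Gy Gz cxy cxz.
  have [-> | nyz] := eqVneq y z; first exact: cocyclic_refl.
  have /gC/forall_inP/(_ z) : y \in vertices (induced g (closed_nbhd g x)).
    by rewrite indE // Gy.
  by rewrite indE // Gz nyz adjE // nyz; apply.
move=> xP; split=> //; apply/forall_inP=> y; rewrite indE // => /andP[Gy cxy].
apply/forall_inP=> z; rewrite indE // => /andP[Gz cxz].
by apply/implyP=> nyz; rewrite adjE // nyz xP.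
Qed.

(** * Equivalent forms of cyclic-transitivity *)

Lemma diamond_free_unique_maximal G :
  diamond_free (enhanced_power_graph G) ->
  forall H, H \subset G -> cyclic H -> H :!=: 1 ->
    exists! M, maximal_cyclic G M /\ H \subset M.
Proof.
move/diamond_freeP=> dfG H sHG cycH ntH.
have [M maxM sHM] := maximal_cyclic_exists sHG cycH.
exists M; split=> // N [maxN sHN].
have [[m defM] [n defN]] :=
  (cyclicP (maximal_cyclic_cyclic maxM), cyclicP (maximal_cyclic_cyclic maxN)).
have /trivgPn[h Hh nth] := ntH.
have [Mh Nh] := (subsetP sHM h Hh, subsetP sHN h Hh).
have Gh := subsetP sHG h Hh.
have Mm : m \in M by rewrite defM cycle_id.
have Nn : n \in N by rewrite defN cycle_id.
have Gm := subsetP (maximal_cyclic_sub maxM) m Mm.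
have Gn := subsetP (maximal_cyclic_sub maxN) n Nn.
have cmh := cyclic_cocyclic (maximal_cyclic_cyclic maxM) Mm Mh.
have chn := cyclic_cocyclic (maximal_cyclic_cyclic maxN) Nh Nn.
apply: (maximal_cyclic_eq maxM maxN defM defN).
(* The four vertices m, 1, h, n are distinct unless m and n are cocyclic. *)
have [-> // | nmh] := eqVneq m h.
have [<- // | nhn] := eqVneq h n.
have [-> | nmn] := eqVneq m n; first exact: cocyclic_refl.
have ntm : m != 1.
  by apply: contra_neq nth => m1; move: Mh; rewrite defM m1 cycle1 => /set1P.
have ntn : n != 1.
  by apply: contra_neq nth => n1; move: Nh; rewrite defN n1 cycle1 => /set1P.
have := dfG m 1 h n; rewrite !adj_epg Gm Gn Gh group1 ntm nmh nmn nhn.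
rewrite !(eq_sym 1) nth ntn !cocyclic1 cmh chn (cocyclicC m 1) cocyclic1.
exact.
Qed.

Lemma unique_maximal_simplicial G :
  (forall H, H \subset G -> cyclic H -> H :!=: 1 ->
    exists! M, maximal_cyclic G M /\ H \subset M) ->
  G^# \subset sl (enhanced_power_graph G).
Proof.
move=> uniqG; apply/subsetP=> x /setD1P[ntx Gx]; apply/sl_epgP; split=> // y z.
move=> Gy Gz /(cocyclic_maximal_cyclic Gx Gy)[M [maxM Mx My]].
case/(cocyclic_maximal_cyclic Gx Gz)=> N [maxN Nx Nz].
have [|||K [_ Kuniq]] := uniqG <[x]>%G; rewrite ?cycle_subG ?cycle_cyclic //.
  by rewrite cycle_eq1.
have eqKM : K = M by apply: Kuniq; rewrite cycle_subG.
have eqKN : K = N by apply: Kuniq; rewrite cycle_subG.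
apply: (cyclic_cocyclic (maximal_cyclic_cyclic maxM)) => //.
by rewrite -eqKM eqKN.
Qed.

(** The parts are the maximal cyclic subgroups: a nontrivial element common to
    two of them is simplicial, so their generators are cocyclic. *)
Lemma simplicial_partition G :
  G^# \subset sl (enhanced_power_graph G) ->
  cyclic G \/ exists P : {set {group gT}},
    nontrivial_partition G P /\ forall H, H \in P -> cyclic H.
Proof.
move=> slG; have [cycG | ncG] := boolP (cyclic G); [by left | right].
have ntG : G :!=: 1 by apply: contraNneq ncG => ->; apply: cyclic1.
have covG x : x \in G -> exists2 M, maximal_cyclic G M & x \in M.
  by move=> Gx; have [M []] := cocyclic_maximal_cyclic Gx Gx (cocyclic_refl x); exists M.
have neqG M : maximal_cyclic G M -> M :!=: G.
  by move/maximal_cyclic_cyclic; apply: contraTneq => ->.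
exists [set M | maximal_cyclic G M]; split=> [|H]; last first.
  by rewrite inE => /maximal_cyclic_cyclic.
split=> //.
- have [M maxM _] := covG 1 (group1 G).
  have /properP[_ [x Gx nMx]] : M \proper G.
    by rewrite properEneq neqG ?maximal_cyclic_sub.
  have [N maxN Nx] := covG x Gx.
  apply/card_gt1P; exists M, N; rewrite !inE maxM maxN; split=> //.
  by apply: contraNneq nMx => ->.
- move=> M; rewrite inE => maxM; split.
    by rewrite properEneq neqG ?maximal_cyclic_sub.
  have /trivgPn[x Gx ntx] := ntG.
  apply: contraNneq ntx => M1.
  have := @mem_maximal_cyclic G M 1 x maxM.
  by rewrite cycle1 M1 => /(_ erefl Gx (cocyclic1 x)) /set1P ->.
- apply/eqP; rewrite eqEsubset; apply/andP; split.
    by apply/subsetP=> x /covG[M maxM Mx]; apply/bigcupP; exists M; rewrite ?inE.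
  by apply/bigcupsP=> M; rewrite inE; apply: maximal_cyclic_sub.
move=> M N; rewrite !inE => maxM maxN nMN; apply/eqP/trivgPn=> -[x].
case/setIP=> Mx Nx ntx; case/eqP: nMN.
have [cycM cycN] := (maximal_cyclic_cyclic maxM, maximal_cyclic_cyclic maxN).
have [[m defM] [n defN]] := (cyclicP cycM, cyclicP cycN).
have Mm : m \in M by rewrite defM cycle_id.
have Nn : n \in N by rewrite defN cycle_id.
have sMG := subsetP (maximal_cyclic_sub maxM).
have sNG := subsetP (maximal_cyclic_sub maxN).
apply: (maximal_cyclic_eq maxM maxN defM defN).
have /sl_epgP[_ xP] : x \in sl (enhanced_power_graph G).
  by rewrite (subsetP slG) // !inE ntx sMG.
apply: (xP m n (sMG m Mm) (sNG n Nn)).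
  exact: cyclic_cocyclic cycM _ _.
exact: cyclic_cocyclic cycN _ _.
Qed.

Lemma cyclic_is_transitive G : cyclic G -> cyclic_transitive G.
Proof.
move=> cycG x y z /setD1P[_ Gx] _ /setD1P[_ Gz] _ _.
exact: (cyclic_cocyclic cycG).
Qed.

(** A cyclic subgroup is generated by one element, so it lies in the part that
    contains this element; y != 1 then determines the part. *)
Lemma partition_transitive G (P : {set {group gT}}) :
    nontrivial_partition G P -> (forall H, H \in P -> cyclic H) ->
  cyclic_transitive G.
Proof.
case=> _ _ _ defG tiP cycP.
have coP u v : u \in G -> v \in G -> cocyclic u v ->
    exists2 H, H \in P & (u \in H) && (v \in H).
  move=> Gu Gv /cyclicP[w defw].
  have Gw : w \in G.
    by rewrite -cycle_subG -defw gen_subG subUset !sub1set Gu.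
  move: Gw; rewrite {1}defG => /bigcupP[H PH Hw]; exists H => //.
  by rewrite -!sub1set -subUset -gen_subG defw cycle_subG.
move=> x y z /setD1P[_ Gx] /setD1P[nty Gy] /setD1P[_ Gz].
move=> /(coP x y Gx Gy)[H PH /andP[Hx Hy]] /(coP y z Gy Gz)[K PK /andP[Ky Kz]].
have eqHK : H = K.
  apply/eqP/idPn=> nHK; case/negP: nty.
  by rewrite -in_set1 -[[set 1]](tiP H K PH PK nHK) inE Hy.
by apply: (cyclic_cocyclic (cycP H PH)); rewrite // eqHK.
Qed.

Lemma transitive_block_graph G :
  cyclic_transitive G -> block_graph (enhanced_power_graph G).
Proof.
move=> trG b bB; apply: (block_complete bB); apply/clique_epgP.
case: bB => c [_ _ [sbc [_ bC bC'] _]].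
have sbg := subgraph_trans sbc (induced_subgraph _ _).
have sVG : vertices b \subset G by case/andP: sbg.
split=> // x y bx by_.
have [-> | ntx] := eqVneq x 1; first exact: cocyclic1.
have [-> | nty] := eqVneq y 1; first by rewrite cocyclicC cocyclic1.
(* Along a walk avoiding the identity, cocyclicity with x propagates. *)
have : connect (adj (delete_vertex b 1)) x y.
  have [b1 | nb1] := boolP (1 \in vertices b).
    by apply: bC'; rewrite // !inE ?bx ?by_.
  apply: (connect_sub _ (bC x y bx by_)) => u v uv; apply: connect1.
  have [bu bv _] := adj_vertices uv.
  by rewrite adj_induced uv !inE !(contraNneq _ nb1) // => <-.
case/connectP=> p; elim/last_ind: p y {by_ nty} => [|p y IHp] z /=.
  by move=> _ ->; apply: cocyclic_refl.
rewrite rcons_path last_rcons => /andP[xp pz] ->.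
move: pz (IHp _ xp erefl); set u := last x p.
rewrite adj_induced => /and3P[/(sub_adj sbg)].
rewrite adj_epg !inE => /and4P[Gu Gy _ cuy] ntu _ cxu.
by apply: (cocyclic_trans trG _ _ Gy cxu cuy); rewrite ?(subsetP sVG) // !inE ntu.
Qed.

(** In a path a, b, c, d either b != 1, so that a and c are cocyclic, or b = 1
    is adjacent to d. *)
Lemma transitive_cograph G :
  cyclic_transitive G -> cograph (enhanced_power_graph G).
Proof.
move=> trG; apply: cograph_chordal => a b c d.
rewrite !adj_epg => /and4P[Ga Gb _ cab] /and4P[_ Gc _ cbc] /and4P[_ Gd _ _].
move=> -> -> ->; rewrite Ga Gb Gc Gd /=.
have [b1 | ntb] := eqVneq b 1; first by rewrite b1 cocyclic1 !orbT.
by rewrite (cocyclic_trans trG Ga _ Gc cab cbc) // !inE ntb.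
Qed.

(** Through a common nontrivial element the union of two cliques is a clique. *)
Lemma transitive_maximal_cliques G A B :
    cyclic_transitive G ->
    maximal_clique (enhanced_power_graph G) A ->
    maximal_clique (enhanced_power_graph G) B ->
  A != B -> A :&: B = 1.
Proof.
move=> trG /maxsetP[/clique_epgP[sAG AC] maxA] /maxsetP[/clique_epgP[sBG BC] maxB].
have clU1 (D : {set gT}) : D \subset G -> {in D &, forall x y, cocyclic x y} ->
    clique (enhanced_power_graph G) (1 |: D).
  move=> sDG DC; apply/clique_epgP; split; first by rewrite subUset sub1set group1.
  move=> x y /setU1P[-> _ | Dx]; first exact: cocyclic1.
  by case/setU1P=> [-> | Dy]; [rewrite cocyclicC cocyclic1 | apply: DC].
have A1 : 1 \in A by rewrite -(maxA _ (clU1 A sAG AC)) ?subsetUr ?setU11.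
have B1 : 1 \in B by rewrite -(maxB _ (clU1 B sBG BC)) ?subsetUr ?setU11.
apply: contraNeq => ntAB.
have [h /setIP[Ah Bh] nth] : exists2 h, h \in A :&: B & h != 1.
  apply/exists_inP; apply: contraNT ntAB => /exists_inPn AB1.
  rewrite eqEsubset; apply/andP; split; last by rewrite sub1set inE A1.
  by apply/subsetP=> h /AB1; rewrite negbK in_set1.
have Gh : h \in G^# by rewrite !inE nth (subsetP sAG).
have clU : clique (enhanced_power_graph G) (A :|: B).
  apply/clique_epgP; split; first by rewrite subUset sAG.
  have ch x : x \in A :|: B -> x \in G /\ cocyclic x h.
    by case/setUP=> Dx; [rewrite (subsetP sAG) ?AC | rewrite (subsetP sBG) ?BC].
  move=> x y /ch[Gx cxh] /ch[Gy cyh].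
  by apply: (cocyclic_trans trG Gx Gh Gy) => //; rewrite cocyclicC.
by rewrite -(maxA _ clU) ?subsetUl // -{2}(maxB _ clU) ?subsetUr.
Qed.

(** Any x and z cocyclic with y lie with 1 and y in a 2-connected induced
    subgraph, whose vertices must then be pairwise cocyclic.  Listing the
    vertices as a set makes coincidences among x, y, z harmless. *)
Lemma block_graph_transitive G :
  block_graph (enhanced_power_graph G) -> cyclic_transitive G.
Proof.
set g := enhanced_power_graph G; move=> gB x y z.
move=> /setD1P[_ Gx] /setD1P[nty Gy] /setD1P[_ Gz] cxy cyz.
pose A := [set 1; y; x; z].
have sAG : A \subset G by rewrite !subUset !sub1set group1 Gx Gy Gz.
have domy : dominating (induced g A) y.
  apply/dominatingP; split=> [|u]; first by rewrite !inE Gy eqxx orbT.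
  rewrite inE => /andP[/= Gu Au] nyu; rewrite adj_induced Au adj_epg Gy Gu nyu.
  rewrite !inE eqxx orbT !andbT /=.
  move: Au; rewrite !inE -!orbA => /or4P[] /eqP-> //.
  - by rewrite cocyclicC cocyclic1.
  - exact: cocyclic_refl.
  by rewrite cocyclicC.
have dom1 : dominating (induced g A) 1.
  by apply/dominating_induced/dominating_epg1; rewrite !inE eqxx.
have /clique_epgP[_] := block_graph_clique gB (induced_subgraph g A)
  (dominating_two_connected nty domy dom1).
by apply; rewrite !inE /= ?Gx ?Gz eqxx ?orbT.
Qed.

Lemma mem_Cyc G x y : (y \in Cyc G x) = (y \in G) && cocyclic y x.
Proof. by rewrite inE. Qed.

(** A nontrivial element cocyclic with all of G makes any two elements
    cocyclic, and then a maximal cyclic subgroup is all of G. *)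
Lemma transitive_Cyc_group G :
  cyclic_transitive G -> ~~ cyclic G -> Cyc_group G = 1.
Proof.
move=> trG ncG; apply/eqP; rewrite eqEsubset sub1set; apply/andP; split; last first.
  by apply/bigcapP=> x Gx; rewrite mem_Cyc group1 cocyclic1.
apply/subsetP=> u /bigcapP Cu; rewrite inE; apply: contraNT ncG => ntu.
have Gu : u \in G^#.
  by have := Cu 1 (group1 G); rewrite mem_Cyc !inE ntu => /andP[].
have cu x : x \in G -> cocyclic u x by move/Cu; rewrite mem_Cyc cocyclicC => /andP[].
have [M maxM _] := maximal_cyclic_exists (sub1G G) (cyclic1 gT).
have [m defM] := cyclicP (maximal_cyclic_cyclic maxM).
have sMG := maximal_cyclic_sub maxM.
have Gm : m \in G by rewrite (subsetP sMG) // defM cycle_id.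
apply: cyclicS (maximal_cyclic_cyclic maxM); apply/subsetP=> x Gx.
apply: (mem_maximal_cyclic maxM defM Gx).
by apply: (cocyclic_trans trG Gm Gu Gx) (cu x Gx); rewrite cocyclicC cu.
Qed.

(** For x != 1, Cyc(x) is the maximal cyclic subgroup M containing x: whatever
    is cocyclic with x is cocyclic with a generator of M. *)
Lemma transitive_C_tidy G : cyclic_transitive G -> C_tidy G.
Proof.
move=> trG x /setDP[Gx nCx].
have ntx : x != 1.
  apply: contraNneq nCx => ->; apply/bigcapP=> y Gy.
  by rewrite mem_Cyc group1 cocyclic1.
have [M [maxM Mx _]] := cocyclic_maximal_cyclic Gx Gx (cocyclic_refl x).
have cycM := maximal_cyclic_cyclic maxM; have [m defM] := cyclicP cycM.
have sMG := subsetP (maximal_cyclic_sub maxM).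
have Mm : m \in M by rewrite defM cycle_id.
exists M; split=> //; apply/setP=> y; rewrite mem_Cyc.
apply/andP/idP=> [[Gy cyx] | My].
  apply: (mem_maximal_cyclic maxM defM Gy).
  have Gx1 : x \in G^# by rewrite !inE ntx.
  apply: (cocyclic_trans trG (sMG m Mm) Gx1 Gy); last by rewrite cocyclicC.
  exact: cyclic_cocyclic cycM _ _.
by split; [apply: sMG | apply: cyclic_cocyclic cycM _ _].
Qed.

Lemma C_tidy_transitive G :
  C_tidy G -> Cyc_group G = 1 -> cyclic_transitive G.
Proof.
move=> tidyG CycG1 x y z /setD1P[_ Gx] Gy /setD1P[_ Gz] cxy cyz.
have [|H [defH cycH]] := tidyG y; first by rewrite CycG1.
apply: (cyclic_cocyclic cycH); rewrite -defH mem_Cyc ?Gx ?Gz //.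
by rewrite cocyclicC.
Qed.

Lemma transitive_diamond_free G :
  cyclic_transitive G -> diamond_free (enhanced_power_graph G).
Proof.
move=> trG; apply/diamond_freeP=> a b c d; rewrite !adj_epg.
case/and4P=> Ga Gb _ cab /and4P[_ Gc _ cac] /and4P[_ _ nbc _].
case/and4P=> _ Gd _ cbd /and4P[_ _ _ ccd] nad; rewrite Ga Gd nad /=.
(* The two dominating vertices of the diamond cannot both be the identity. *)
have [b1 | ntb] := eqVneq b 1.
  apply: (cocyclic_trans trG Ga _ Gd cac ccd).
  by rewrite !inE -b1 eq_sym nbc.
by apply: (cocyclic_trans trG Ga _ Gd cab cbd); rewrite !inE ntb.
Qed.

End EnhancedPowerGraph.

Theorem theorem5p3 (gT : finGroupType) (G : {group gT}) :
  [<-> (* (a) *) diamond_free (enhanced_power_graph G);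
       (* (b) *) forall H : {group gT}, H \subset G -> cyclic H -> H :!=: 1 ->
                   exists! M : {group gT}, maximal_cyclic G M /\ H \subset M;
       (* (c) *) G^# \subset sl (enhanced_power_graph G);
       (* (d) *) cyclic G \/
                   exists P : {set {group gT}},
                     nontrivial_partition G P /\ forall H, H \in P -> cyclic H;
       (* (e) *) [/\ block_graph (enhanced_power_graph G),
                     cograph (enhanced_power_graph G) &
                     forall A B : {set gT},
                       maximal_clique (enhanced_power_graph G) A ->
                       maximal_clique (enhanced_power_graph G) B ->
                       A != B -> A :&: B = 1];
       (* (f) *) block_graph (enhanced_power_graph G);
       (* (g) *) cyclic G \/ (C_tidy G /\ Cyc_group G = 1);
       (* (h) *) cyclic_transitive G].
Proof.
tfae.
- exact: diamond_free_unique_maximal.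
- exact: unique_maximal_simplicial.
- exact: simplicial_partition.
- move=> partG; have trG : cyclic_transitive G.
    case: partG => [/cyclic_is_transitive // | [P [partP cycP]]].
    exact: partition_transitive partP cycP.
  split=> [||A B]; [exact: transitive_block_graph | exact: transitive_cograph |].
  exact: transitive_maximal_cliques.
- by case.
- move=> /block_graph_transitive trG.
  have [cycG | ncG] := boolP (cyclic G); [by left | right].
  by split; [apply: transitive_C_tidy | apply: transitive_Cyc_group].
- by case=> [/cyclic_is_transitive // | [tidyG /(C_tidy_transitive tidyG)]].
- exact: transitive_diamond_free.
Qed.
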